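(* Assume: (BoS) for each $d\in\mathcal D$, $\mathrm{Supp}(Y_d\mid D\ne d)=\mathrm{Supp}(Y_d\mid D=d)=[\underline y_d,\overline y_d]$ with $\underline y_d,\overline y_d\in\mathbb R$; (SDC) $\mathrm{Cov}(Y_d,D)\,\mathrm{Cov}(Y_d,Z)\ge 0$ for each $d\in\mathcal D$; (LEI) $|\rho_{Y_dD}|\ge|\rho_{Y_dZ}|$ for each $d\in\mathcal D$; (MTR) $Y_d\ge Y_{d'}$ (almost surely) for all $d>d'$ in $\mathcal D$. Then for each $d\in\mathcal D$, the potential outcome mean $\theta_d=\mathrm{E}[Y_d]$ satisfies $\theta_d\in I^d_{MTR}:= I^d_{MTR1}\cup I^d_{MTR2}$, where $$I_{MTR1}^d=\Big[\sup_{(\alpha,\beta,\mu)\in[0,1]^3}\mathrm{E}\big[\underline m_d(Y,D,\delta_L^-)\big],\ \inf_{(\alpha,\beta,\mu)\in[0,1]^3}\mathrm{E}\big[\overline m_d(Y,D,\delta_L^+)\big]\Big],$$ $$I_{MTR2}^d=\Big[\sup_{(\alpha,\beta,\mu)\in[0,1]^3}\mathrm{E}\big[\underline m_d(Y,D,\delta_L^+)\big],\ \inf_{(\alpha,\beta,\mu)\in[0,1]^3}\mathrm{E}\big[\overline m_d(Y,D,\delta_L^-)\big]\Big].$$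
   Context: Setting: all random variables live on one probability space. $D$ is a discrete random variable (treatment) with values in $\mathcal D=\{1,\dots,T\}$; for each $d\in\mathcal D$, $Y_d$ is an integrable real random variable (potential outcome); the observed outcome is $Y=\sum_{d=1}^T Y_d\,\mathbf 1\{D=d\}$; $Z$ is a real random variable (imperfect instrument). $Y_d$, $D$, $Z$ have finite positive variances; $\sigma_D,\sigma_Z$ are the standard deviations of $D,Z$, and $\rho_{UV}$ is the correlation coefficient of $U$ and $V$. Write $\tilde D=D-\mathrm{E}[D]$, $\tilde Z=Z-\mathrm{E}[Z]$. For $(\alpha,\beta,\mu)\in[0,1]^3$ define $$\delta_L^{\pm}=1\pm\alpha\big((1-\beta)\mu(\tilde D\sigma_Z-\tilde Z\sigma_D)+\beta\tilde D+(1-\beta)(1-\mu)\tilde Z\big).$$ For real (or random) $\delta$ define $$\underline m_d(Y,D,\delta)=\mathbf 1\{D=d\}\,\delta Y+\mathbf 1\{D>d\}\min\{\delta\underline y_d,\delta Y\}+\mathbf 1\{D<d\}\min\{\delta\overline y_d,\delta Y\},$$ $$\overline m_d(Y,D,\delta)=\mathbf 1\{D=d\}\,\delta Y+\mathbf 1\{D>d\}\max\{\delta\underline y_d,\delta Y\}+\mathbf 1\{D<d\}\max\{\delta\overline y_d,\delta Y\}.$$ Here $\mathrm{Supp}(Y_d\mid A)$ is the support of the conditional distribution of $Y_d$ given the event $A$ (assumed of positive probability). An interval $[a,b]$ with $a>b$ is the empty set. *)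

(* Defs.v *)
From HB Require Import structures.
From mathcomp Require Import all_boot all_order all_algebra.
From mathcomp Require Import all_classical all_reals all_analysis.

Set Implicit Arguments.
Unset Strict Implicit.
Unset Printing Implicit Defensive.

Import Order.TTheory GRing.Theory Num.Theory.
Import numFieldNormedType.Exports.

Local Open Scope classical_set_scope.
Local Open Scope ring_scope.

Section probability_notions.
Context {disp : measure_display} {Omega : measurableType disp} {R : realType}.
Variable P : probability Omega R.

Definition std_dev (X : Omega -> R) : R := Num.sqrt (fine 'V_P[X]).

Definition correlation (X Y : Omega -> R) : R :=
  fine (covariance P X Y) / (std_dev X * std_dev Y).

Definition centered (X : Omega -> R) : Omega -> R :=
  fun w => X w - fine 'E_P[X].

(* Meaningful when [P A > 0]; identically 0 when [P A = 0]. *)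
Definition cond_probability (A B : set Omega) : \bar R :=
  (P (B `&` A) * ((fine (P A))^-1)%:E)%E.

Definition support (mu : set R -> \bar R) : set R :=
  [set y | forall U : set R, open U -> U y -> (0 < mu U)%E].

Definition cond_support (X : Omega -> R) (A : set Omega) : set R :=
  support (pushforward (cond_probability A) X).

End probability_notions.

(* Treatments are indexed by ['I_T = {0, ..., T-1}]; the index [d] stands for
   the treatment value [d + 1], so that the values are [1, ..., T]. *)
Definition level (R : realType) (T : nat) (d : 'I_T) : R := d.+1%:R.

Definition observed (Omega : Type) (R : realType) (T : nat)
    (Y : 'I_T -> Omega -> R) (D : Omega -> R) : Omega -> R :=
  fun w => \sum_(d < T) Y d w * (D w == level R d)%:R.

Section bounds.
Context {disp : measure_display} {Omega : measurableType disp} {R : realType}.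
Variable P : probability Omega R.

(* The random variable multiplied by [alpha] in the weights below. *)
Definition drift (D Z : Omega -> R) (b m : R) : Omega -> R := fun w =>
  (1 - b) * m * (centered P D w * std_dev P Z - centered P Z w * std_dev P D)
  + b * centered P D w + (1 - b) * (1 - m) * centered P Z w.

(* The parameter is the triple [((alpha, beta), mu)]. *)
Definition deltaL_plus (D Z : Omega -> R) (abm : R * R * R) : Omega -> R :=
  let: (a, b, m) := abm in fun w => 1 + a * drift D Z b m w.

Definition deltaL_minus (D Z : Omega -> R) (abm : R * R * R) : Omega -> R :=
  let: (a, b, m) := abm in fun w => 1 - a * drift D Z b m w.

Definition unit_cube : set (R * R * R) := `[0, 1] `*` `[0, 1] `*` `[0, 1].

(* [d] is the treatment value, [ylo] and [yhi] are the end points of the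
   support of the corresponding potential outcome. *)
Definition m_low (d ylo yhi y D delta : R) : R :=
  (D == d)%:R * (delta * y)
  + (d < D)%R%:R * Num.min (delta * ylo) (delta * y)
  + (D < d)%R%:R * Num.min (delta * yhi) (delta * y).

Definition m_up (d ylo yhi y D delta : R) : R :=
  (D == d)%:R * (delta * y)
  + (d < D)%R%:R * Num.max (delta * ylo) (delta * y)
  + (D < d)%R%:R * Num.max (delta * yhi) (delta * y).

Definition E_m_low (d ylo yhi : R) (Y D delta : Omega -> R) : \bar R :=
  'E_P[fun w => m_low d ylo yhi (Y w) (D w) (delta w)].

Definition E_m_up (d ylo yhi : R) (Y D delta : Omega -> R) : \bar R :=
  'E_P[fun w => m_up d ylo yhi (Y w) (D w) (delta w)].

(* Intervals of extended reals; such an interval is empty when its lower end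
   point exceeds its upper one. *)
Definition I_MTR1 (d ylo yhi : R) (Y D Z : Omega -> R) : set (\bar R) :=
  `[ereal_sup [set E_m_low d ylo yhi Y D (deltaL_minus D Z t)
              | t in unit_cube],
    ereal_inf [set E_m_up d ylo yhi Y D (deltaL_plus D Z t)
              | t in unit_cube]].

Definition I_MTR2 (d ylo yhi : R) (Y D Z : Omega -> R) : set (\bar R) :=
  `[ereal_sup [set E_m_low d ylo yhi Y D (deltaL_plus D Z t)
              | t in unit_cube],
    ereal_inf [set E_m_up d ylo yhi Y D (deltaL_minus D Z t)
              | t in unit_cube]].

Definition I_MTR (d ylo yhi : R) (Y D Z : Omega -> R) : set (\bar R) :=
  I_MTR1 d ylo yhi Y D Z `|` I_MTR2 d ylo yhi Y D Z.

End bounds.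

(* Main.v *)
(* By SDC and LEI the covariances of Y_d with D and with Z have the same weak
   sign, and sigma_Z Cov(Y_d, D) - sigma_D Cov(Y_d, Z) shares it. Hence
   E[drift * Y_d] has that sign for all (beta, mu), so that theta_d lies between
   E[deltaL^- Y_d] and E[deltaL^+ Y_d], in an order which does not depend on the
   parameters. Bounded support and monotone response sandwich Y_d almost surely
   between the observed outcome and an end point of the support, whence
   m_low(delta) <= delta * Y_d <= m_up(delta) whatever the sign of delta. *)

Require Import Defs.
From HB Require Import structures.
From mathcomp Require Import all_boot all_order all_algebra.
From mathcomp Require Import all_classical all_reals all_analysis.
From mathcomp Require Import measurable_realfun ring lra.

Set Implicit Arguments.
Unset Strict Implicit.
Unset Printing Implicit Defensive.

Import Order.TTheory GRing.Theory Num.Theory.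
Import numFieldNormedType.Exports.

Local Open Scope classical_set_scope.
Local Open Scope ring_scope.

(* No integrability is needed: with the convention +oo - oo = -oo the integral
   is monotone in the positive part and antitone in the negative part. *)
Lemma ae_le_expectation d (T : measurableType d) (R : realType)
    (P : probability T R) (f g : T -> R) :
  measurable_fun setT f -> measurable_fun setT g ->
  {ae P, forall w, f w <= g w} -> ('E_P[f] <= 'E_P[g])%E.
Proof.
move=> mf mg fg.
(* Replacing [g] by [max f g], which equals [g] almost surely, makes the inequality hold everywhere,
   so that positive and negative parts compare pointwise. *)
have mh : measurable_fun setT (fun w => Num.max (f w) (g w)).
  exact: measurable_maxr.
have -> : ('E_P[g] = 'E_P[fun w => Num.max (f w) (g w)])%E.
  rewrite expectation.unlock; apply: ae_eq_integral => //.
  - exact/measurable_EFinP.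
  - exact/measurable_EFinP.
  - by apply: filterS fg => w fgw _ /=; rewrite max_r.
rewrite expectation.unlock integralE [leRHS]integralE; apply: leeB.
  apply: ge0_le_integral => //.
  - by apply/measurable_funepos/measurable_EFinP.
  - by apply/measurable_funepos/measurable_EFinP.
  - move=> w _; apply: (@funepos_le _ _ setT) => [x _|]; last by rewrite inE.
    by rewrite lee_fin le_max lexx.
apply: ge0_le_integral => //.
- by apply/measurable_funeneg/measurable_EFinP.
- by apply/measurable_funeneg/measurable_EFinP.
- move=> w _; apply: (@funeneg_le _ _ setT) => [x _|]; last by rewrite inE.
  by rewrite lee_fin le_max lexx.
Qed.

(** Only countably many rational balls exist, so almost surely [X w] avoids every ball that has no
    mass on [A]. Any open set around [X w] contains a rational ball around [X w], which then has
    mass. *)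
Lemma ae_cond_support d (T : measurableType d) (R : realType)
    (P : probability T R) (X : {RV P >-> R}) (A : set T) :
  measurable A -> (0 < P A)%E ->
  {ae P, forall w, A w -> cond_support P X A (X w)}.
Proof.
move=> mA PA0.
pose N (cr : rat * rat) := X @^-1` ball (ratr cr.1 : R) (ratr cr.2) `&` A.
have mN cr : measurable (N cr).
  apply: measurableI => //; apply: measurable_funPTI.
  by apply: open_measurable; exact: ball_open.
(* Pairs of rationals are coded by naturals, so that a countable union of null sets applies. *)
have aeN : {ae P, forall w, forall n, forall cr,
    unpickle n = Some cr -> P (N cr) = 0%E -> ~ N cr w}.
  apply: ae_foralln => n; case: (unpickle n) => [cr|]; last exact: aeW.
  have [PN0|PN0] := pselect (P (N cr) = 0%E); last first.
    by apply: aeW => w _ [<-].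
  exists (N cr); split=> // w /= H.
  by apply: contrapT => Nw; apply: H => _ [<-].
apply: filterS aeN => w Nw Aw U oU UXw.
rewrite /pushforward /cond_probability.
have PAV : (0 < (fine (P A))^-1)%R.
  by rewrite invr_gt0 fine_gt0 // PA0 (le_lt_trans (probability_le1 P mA)) ?ltry.
have [c [r [/set_mem Xwcr crU]]] := open_subball_rat oU (mem_set UXw).
have := Nw _ _ (pickleK (c, r)).
rewrite mule_gt0 // lt0e measure_ge0 andbT.
apply/negP => /eqP PU0; apply: (Nw _ _ (pickleK (c, r))) => //=.
apply/eqP; rewrite eq_le measure_ge0 andbT -PU0 le_measure ?inE //.
- apply: measurableI => //; apply: measurable_funPTI; exact: open_measurable.
- by apply: setSI => x /crU.
Qed.

(** * Centered variables, finite variance and covariances *)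

Section centered_variables.
Context d (T : measurableType d) (R : realType) (P : probability T R).
Implicit Types X Y Z : {RV P >-> R}.

Lemma integrable_dominated (f g : T -> R) : measurable_fun setT f ->
  (forall w, `|f w| <= g w) -> P.-integrable setT (EFin \o g) ->
  P.-integrable setT (EFin \o f).
Proof.
move=> mf fg; apply: le_integrable => //; first exact/measurable_EFinP.
by move=> w _; rewrite /= lee_fin (le_trans (fg w)) ?ler_norm.
Qed.

Lemma measurable_centered X : measurable_fun setT (centered P X).
Proof. by apply: measurable_funB => //; exact: measurable_cst. Qed.

Lemma integrable_centered_sqr X : ('V_P[X] < +oo)%E ->
  P.-integrable setT (EFin \o (fun w => centered P X w ^+ 2)).
Proof.
move=> VX; apply/integrableP; split.
  apply/measurable_EFinP; apply: measurable_funX; exact: measurable_centered.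
move: VX; rewrite /variance covariance.unlock expectation.unlock.
apply: le_lt_trans; rewrite le_eqVlt; apply/orP; left; apply/eqP.
by apply: eq_integral => w _; rewrite /= ger0_norm ?sqr_ge0 // expr2 /centered
  expectation.unlock.
Qed.

(** The bound [|x| <= 1 + x ^+ 2] at [x = X w - c] dominates [X]. There is no circularity: [c = fine
    'E_P[X]] is a real number even before the expectation is known to be finite. *)
Lemma integrable_finite_variance X : ('V_P[X] < +oo)%E ->
  P.-integrable setT (EFin \o X).
Proof.
move=> VX; pose c : R := fine 'E_P[X].
apply: (@integrable_dominated _ (fun w => (1 + `|c|) + centered P X w ^+ 2)) => //.
- move=> w; have -> : X w = centered P X w + c by rewrite /centered subrK.
  have := ler_normD (centered P X w) c; set x := centered P X w.
  have : `|x| <= 1 + x ^+ 2.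
    by rewrite ler_norml; apply/andP; split; nra.
  by lra.
- have -> : EFin \o (fun w => (1 + `|c|) + centered P X w ^+ 2)
      = ((EFin \o cst (1 + `|c|)%R)
        \+ (EFin \o (fun w => centered P X w ^+ 2)%R))%E.
    by apply/funext.
  apply: integrableD => //; last exact: integrable_centered_sqr.
  exact: finite_measure_integrable_cst.
Qed.

Lemma integrable_centeredM X Y : ('V_P[X] < +oo)%E -> ('V_P[Y] < +oo)%E ->
  P.-integrable setT (EFin \o (fun w => centered P X w * centered P Y w)).
Proof.
move=> VX VY.
apply: (@integrable_dominated _
    (fun w => centered P X w ^+ 2 + centered P Y w ^+ 2)).
- by apply: measurable_funM; exact: measurable_centered.
- by move=> w; rewrite ler_norml; apply/andP; split; nra.
- have -> : EFin \o (fun w => centered P X w ^+ 2 + centered P Y w ^+ 2)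
      = ((EFin \o (fun w => centered P X w ^+ 2)%R)
        \+ (EFin \o (fun w => centered P Y w ^+ 2)%R))%E by apply/funext.
  by apply: integrableD => //; exact: integrable_centered_sqr.
Qed.

Lemma covarianceE_centered X Y :
  covariance P X Y = ('E_P[fun w => (centered P X w * centered P Y w)%R])%E.
Proof. by rewrite covariance.unlock. Qed.

Lemma covariance_fin_num_centered X Y :
  ('V_P[X] < +oo)%E -> ('V_P[Y] < +oo)%E -> covariance P X Y \is a fin_num.
Proof.
move=> VX VY; rewrite covarianceE_centered; apply: expectation_fin_num.
exact/Lfun1_integrable/integrable_centeredM.
Qed.

Lemma Lfun1_centered X : ('V_P[X] < +oo)%E -> centered P X \in Lfun P 1.
Proof.
move=> VX; have LX : (X : T -> R) \in Lfun P 1.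
  exact/Lfun1_integrable/integrable_finite_variance.
have -> : centered P X = (X : T -> R) - cst (fine 'E_P[X]) by apply/funext.
by apply: rpredB => //; exact: Lfun_cst.
Qed.

Lemma expectation_centered X : ('V_P[X] < +oo)%E -> ('E_P[centered P X] = 0)%E.
Proof.
move=> VX; have LX : (X : T -> R) \in Lfun P 1.
  exact/Lfun1_integrable/integrable_finite_variance.
have -> : centered P X = (X : T -> R) \- cst (fine 'E_P[X]) by apply/funext.
rewrite expectationB //; last exact: Lfun_cst.
rewrite expectation_cst fineK ?subee ?expectation_fin_num //.
Qed.

Lemma Lfun1_mul_centered X Y : ('V_P[X] < +oo)%E -> ('V_P[Y] < +oo)%E ->
  (fun w => Y w * centered P X w) \in Lfun P 1.
Proof.
move=> VX VY.
have -> : (fun w => Y w * centered P X w) =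
    (fun w => centered P Y w * centered P X w)
    + fine 'E_P[Y] \o* centered P X.
  apply/funext => w /=; rewrite [RHS]/GRing.add /= /centered; ring.
apply: rpredD; first exact/Lfun1_integrable/integrable_centeredM.
by apply: Lfun_scale => //; exact: Lfun1_centered.
Qed.

(** Centering one factor is enough: the constant [fine 'E_P[Y]] multiplies a variable of mean
    zero. *)
Lemma expectation_mul_centered X Y : ('V_P[X] < +oo)%E -> ('V_P[Y] < +oo)%E ->
  ('E_P[fun w => (Y w * centered P X w)%R] = covariance P Y X)%E.
Proof.
move=> VX VY.
have -> : (fun w => Y w * centered P X w) =
    (fun w => centered P Y w * centered P X w)
    \+ fine 'E_P[Y] \o* centered P X.
  by apply/funext => w /=; rewrite /centered; ring.
rewrite expectationD.
- rewrite expectationZl ?Lfun1_centered // expectation_centered // mule0 adde0.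
  by rewrite covarianceE_centered.
- exact/Lfun1_integrable/integrable_centeredM.
- by apply: Lfun_scale => //; exact: Lfun1_centered.
Qed.

(** Both weights are one plus a linear combination of the centered treatment and instrument; this
    reduces the weighted mean of an outcome to two covariances. *)
Lemma expectation_affine_weight X Z Y (k l : R) : ('V_P[X] < +oo)%E ->
  ('V_P[Z] < +oo)%E -> ('V_P[Y] < +oo)%E ->
  ('E_P[fun w => ((1 + (k * centered P X w + l * centered P Z w)) * Y w)%R] =
   'E_P[Y] + (k * fine (covariance P Y X) + l * fine (covariance P Y Z))%:E)%E.
Proof.
move=> VX VZ VY.
have LYX := Lfun1_mul_centered VX VY.
have LYZ := Lfun1_mul_centered VZ VY.
have LY : (Y : T -> R) \in Lfun P 1.
  exact/Lfun1_integrable/integrable_finite_variance.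
have -> : (fun w => (1 + (k * centered P X w + l * centered P Z w)) * Y w) =
    (Y : T -> R) \+ ((k \o* (fun w => Y w * centered P X w))
      \+ (l \o* (fun w => Y w * centered P Z w))).
  by apply/funext => w /=; ring.
rewrite expectationD //; last first.
  by apply: rpredD; exact: Lfun_scale.
rewrite expectationD; [|exact: Lfun_scale|exact: Lfun_scale].
rewrite !expectationZl // !expectation_mul_centered // EFinD !EFinM.
by rewrite !fineK // covariance_fin_num_centered.
Qed.

End centered_variables.

(** * Pointwise sandwich between [m_low] and [m_up] *)

(** Off [D = d], [yd] lies between [y] and an end point. Multiplication by [delta] keeps or reverses
    this order, so the smaller of the two products is a lower bound; the sign of [delta] decides
    which one is used. *)
Lemma m_low_le (R : realType) (d ylo yhi y D delta yd : R) :
  (D = d -> y = yd) -> (d < D -> ylo <= yd <= y) ->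
  (D < d -> y <= yd <= yhi) -> m_low d ylo yhi y D delta <= delta * yd.
Proof.
move=> yE ylow yup; rewrite /m_low.
case: (ltgtP D d) => [/yup|/ylow|/yE ->]; rewrite ?mul0r ?mul1r ?addr0 ?add0r //.
  move=> /andP[h1 h2]; rewrite ge_min; apply/orP.
  by have [d0|/ltW d0] := leP 0 delta; [right|left]; nra.
move=> /andP[h1 h2]; rewrite ge_min; apply/orP.
by have [d0|/ltW d0] := leP 0 delta; [left|right]; nra.
Qed.

Lemma le_m_up (R : realType) (d ylo yhi y D delta yd : R) :
  (D = d -> y = yd) -> (d < D -> ylo <= yd <= y) ->
  (D < d -> y <= yd <= yhi) -> delta * yd <= m_up d ylo yhi y D delta.
Proof.
move=> yE ylow yup; rewrite /m_up.
case: (ltgtP D d) => [/yup|/ylow|/yE ->]; rewrite ?mul0r ?mul1r ?addr0 ?add0r //.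
  move=> /andP[h1 h2]; rewrite le_max; apply/orP.
  by have [d0|/ltW d0] := leP 0 delta; [left|right]; nra.
move=> /andP[h1 h2]; rewrite le_max; apply/orP.
by have [d0|/ltW d0] := leP 0 delta; [right|left]; nra.
Qed.

(** * Measurability of the observed outcome and of the bounds *)

Section measurable_bounds.
Context d (T : measurableType d) (R : realType).

Lemma measurable_natr_bool (f : T -> bool) : measurable_fun setT f ->
  measurable_fun setT (fun w => (f w)%:R : R).
Proof.
move=> mf; have -> : (fun w => (f w)%:R : R) = (fun w => if f w then 1 else 0).
  by apply/funext => w; case: (f w).
by apply: measurable_fun_ifT => //; exact: measurable_cst.
Qed.

Lemma measurable_observed n (Y : 'I_n -> {mfun T >-> R}) (D : {mfun T >-> R}) :
  measurable_fun setT (observed Y D).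
Proof.
apply: measurable_sum => i; apply: measurable_funM => //.
by apply: measurable_natr_bool; exact: measurable_fun_eqr.
Qed.

Lemma measurable_m_low (x ylo yhi : R) (Y D delta : T -> R) :
  measurable_fun setT Y -> measurable_fun setT D ->
  measurable_fun setT delta ->
  measurable_fun setT (fun w => m_low x ylo yhi (Y w) (D w) (delta w)).
Proof.
move=> mY mD mdelta; have mM := measurable_funM mdelta mY.
apply: measurable_funD; first apply: measurable_funD.
- apply: measurable_funM mM.
  by apply: measurable_natr_bool; exact: measurable_fun_eqr.
- apply: measurable_funM.
    by apply: measurable_natr_bool; exact: measurable_fun_ltr.
  by apply: measurable_minr => //; exact: measurable_funM.
- apply: measurable_funM.
    by apply: measurable_natr_bool; exact: measurable_fun_ltr.
  by apply: measurable_minr => //; exact: measurable_funM.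
Qed.

Lemma measurable_m_up (x ylo yhi : R) (Y D delta : T -> R) :
  measurable_fun setT Y -> measurable_fun setT D ->
  measurable_fun setT delta ->
  measurable_fun setT (fun w => m_up x ylo yhi (Y w) (D w) (delta w)).
Proof.
move=> mY mD mdelta; have mM := measurable_funM mdelta mY.
apply: measurable_funD; first apply: measurable_funD.
- apply: measurable_funM mM.
  by apply: measurable_natr_bool; exact: measurable_fun_eqr.
- apply: measurable_funM.
    by apply: measurable_natr_bool; exact: measurable_fun_ltr.
  by apply: measurable_maxr => //; exact: measurable_funM.
- apply: measurable_funM.
    by apply: measurable_natr_bool; exact: measurable_fun_ltr.
  by apply: measurable_maxr => //; exact: measurable_funM.
Qed.

End measurable_bounds.

(** * Observed outcome at a given level; signs of the covariances *)

Lemma observed_level (Omega : Type) (R : realType) n (Y : 'I_n -> Omega -> R)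
    (D : Omega -> R) w (i : 'I_n) :
  D w = level R i -> observed Y D w = Y i w.
Proof.
move=> Dw; rewrite /observed (bigD1 i) //= Dw eqxx mulr1 big1 ?addr0 // => j ji.
rewrite /level eqr_nat eqSS (_ : (i == j :> nat) = false) ?mulr0 //.
by apply/negbTE; rewrite eq_sym.
Qed.

(* The right-hand side is E[drift * Y_d]; grouped around CD * sZ - CZ * sD it is
   a combination of nonnegative quantities with nonnegative weights. *)
Lemma drift_coef_ge0 (R : realType) (CD CZ sD sZ b m : R) :
  0 <= CD -> 0 <= CZ -> CZ * sD <= CD * sZ -> 0 <= b <= 1 -> 0 <= m <= 1 ->
  0 <= ((1 - b) * m * sZ + b) * CD
       + ((1 - b) * (1 - m) - (1 - b) * m * sD) * CZ.
Proof.
move=> CD0 CZ0 CDZ /andP[b0 b1] /andP[m0 m1].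
have -> : ((1 - b) * m * sZ + b) * CD
       + ((1 - b) * (1 - m) - (1 - b) * m * sD) * CZ =
    (1 - b) * m * (CD * sZ - CZ * sD) + b * CD + (1 - b) * (1 - m) * CZ by ring.
by rewrite !addr_ge0 // !mulr_ge0 // subr_ge0.
Qed.

(** Clearing the positive denominators turns the correlation bound into [|CZ| * sD <= |CD| * sZ];
    the common sign then removes the absolute values. The second alternative is the first one for
    [- CD] and [- CZ], so that [drift_coef_ge0] serves both. *)
Lemma same_sign_covariances (R : realType) (CD CZ sD sZ sY : R) :
  0 < sD -> 0 < sZ -> 0 < sY -> 0 <= CD * CZ ->
  `|CZ / (sY * sZ)| <= `|CD / (sY * sD)| ->
  [/\ 0 <= CD, 0 <= CZ & CZ * sD <= CD * sZ] \/
  [/\ 0 <= - CD, 0 <= - CZ & - CZ * sD <= - CD * sZ].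
Proof.
move=> sD0 sZ0 sY0 C0.
rewrite !normrM !normfV !normrM !(gtr0_norm sD0) !(gtr0_norm sZ0).
rewrite !(gtr0_norm sY0) ler_pdivrMr ?mulr_gt0 // mulrAC ler_pdivlMr ?mulr_gt0 //.
rewrite [leLHS](_ : _ = sY * (`|CZ| * sD)); last by ring.
rewrite [leRHS](_ : _ = sY * (`|CD| * sZ)); last by ring.
rewrite ler_pM2l // => h.
have [CD0|CD0|CD0] := ltgtP CD 0; last 1 first.
(* For [CD = 0] the product condition says nothing about [CZ]; the correlation bound forces
   [CZ = 0]. *)
- move: h; rewrite CD0 normr0 mul0r pmulr_lle0 // normr_le0 => /eqP ->.
  by left; rewrite lexx !mul0r.
- have CZ0 : CZ <= 0 by rewrite -(nmulr_rge0 _ CD0).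
  move: h; rewrite ler0_norm // ltr0_norm // => h.
  by right; split; rewrite ?oppr_ge0 // ltW.
- have CZ0 : 0 <= CZ by rewrite -(pmulr_rge0 _ CD0).
  move: h; rewrite ger0_norm // gtr0_norm // => h.
  by left; split=> //; exact: ltW.
Qed.

(** * Weighted means of an outcome and their bounds by observables *)

Section bounds_proof.
Context d (Omega : measurableType d) (R : realType) (P : probability Omega R).

Lemma std_dev_gt0 (X : {RV P >-> R}) : (0 < 'V_P[X] < +oo)%E ->
  0 < std_dev P X.
Proof. by move=> VX; rewrite sqrtr_gt0 fine_gt0. Qed.

Lemma driftE (D Z : Omega -> R) (b m : R) w :
  drift P D Z b m w =
    ((1 - b) * m * std_dev P Z + b) * centered P D w
    + ((1 - b) * (1 - m) - (1 - b) * m * std_dev P D) * centered P Z w.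
Proof. by rewrite /drift; ring. Qed.

Lemma measurable_drift (D Z : {RV P >-> R}) (b m : R) :
  measurable_fun setT (drift P D Z b m).
Proof.
rewrite (funext (driftE D Z b m)).
by apply: measurable_funD; apply: measurable_funM => //; exact: measurable_centered.
Qed.

(** The real [a] has no sign restriction: [- a] gives the weight [deltaL_minus]. *)
Lemma expectation_drift_weight (D Z Y : {RV P >-> R}) (a b m : R) :
  ('V_P[D] < +oo)%E -> ('V_P[Z] < +oo)%E -> ('V_P[Y] < +oo)%E ->
  ('E_P[fun w => ((1 + a * drift P D Z b m w) * Y w)%R] = 'E_P[Y] +
    (a * (((1 - b) * m * std_dev P Z + b) * fine (covariance P Y D)
    + ((1 - b) * (1 - m) - (1 - b) * m * std_dev P D)
      * fine (covariance P Y Z)))%:E)%E.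
Proof.
move=> VD VZ VY.
under eq_fun do rewrite driftE mulrDr !(mulrA a).
by rewrite expectation_affine_weight //; congr (_ + _%:E)%E; ring.
Qed.

Variables (T : nat) (D Z : {RV P >-> R}) (Y : 'I_T -> {RV P >-> R}).
Hypothesis D_values : forall w, exists i : 'I_T, D w = level R i.
Variables (ylo yhi : 'I_T -> R).

(** The events [D = level i] and [D <> level i] cover the space and carry the same conditional
    support, so the bound becomes unconditional. *)
Lemma ae_support_bounds (i : 'I_T) :
  (0 < P [set w | D w = level R i])%E ->
  (0 < P [set w | D w <> level R i])%E ->
  cond_support P (Y i) [set w | D w <> level R i] = `[ylo i, yhi i]%classic ->
  cond_support P (Y i) [set w | D w = level R i] = `[ylo i, yhi i]%classic ->
  {ae P, forall w, ylo i <= Y i w <= yhi i}.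
Proof.
move=> Peq Pneq Sneq Seq.
have mA : measurable [set w | D w = level R i].
  exact: (@measurable_funPTI _ _ _ _ D [set level R i]).
have mAC : measurable [set w | D w <> level R i] by exact: measurableC.
apply: filterS2 (ae_cond_support (Y i) mA Peq) (ae_cond_support (Y i) mAC Pneq).
move=> w; rewrite Seq Sneq /= in_itv /= => eqH neqH.
by have [/eqH|/neqH] := pselect (D w = level R i).
Qed.

Hypothesis MTR : forall i j : 'I_T, (j < i)%N ->
  {ae P, forall w, Y j w <= Y i w}.

(** There are finitely many pairs, so one null set serves them all; the realized treatment, which
    varies with [w], can then be used as an index. *)
Lemma ae_monotone : {ae P, forall w, forall i j : 'I_T, (j < i)%N ->
  Y j w <= Y i w}.
Proof.
apply: filter_forall => i; apply: filter_forall => j.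
have [ji|ij] := ltnP j i; last by apply: aeW.
by apply: filterS (MTR ji).
Qed.

Variable i : 'I_T.
Hypothesis Y_bounds : {ae P, forall w, ylo i <= Y i w <= yhi i}.

(** The observed outcome is [Y j w] for the realized index [j]. Monotone response compares it with
    [Y i w] on one side, and the support bounds [Y i w] on the other. *)
Lemma observed_order : {ae P, forall w,
  [/\ D w = level R i -> observed Y D w = Y i w,
      level R i < D w -> ylo i <= Y i w <= observed Y D w
    & D w < level R i -> observed Y D w <= Y i w <= yhi i]}.
Proof.
apply: filterS2 ae_monotone Y_bounds => w mono /andP[lo hi].
have [j Dw] := D_values w; rewrite Dw (observed_level Y Dw); split.
- by move=> /eqP; rewrite eqr_nat eqSS => /eqP/val_inj ->.
- by rewrite ltr_nat ltnS => ij; rewrite lo mono.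
- by rewrite ltr_nat ltnS => ji; rewrite hi mono.
Qed.

Variable delta : Omega -> R.
Hypothesis mdelta : measurable_fun setT delta.

Lemma E_m_low_le :
  (E_m_low P (level R i) (ylo i) (yhi i) (observed Y D) D delta <=
   'E_P[fun w => (delta w * Y i w)%R])%E.
Proof.
apply: ae_le_expectation.
- by apply: measurable_m_low => //; exact: measurable_observed.
- exact: measurable_funM.
- by apply: filterS observed_order => w [? ? ?]; exact: m_low_le.
Qed.

Lemma le_E_m_up :
  ('E_P[fun w => (delta w * Y i w)%R] <=
   E_m_up P (level R i) (ylo i) (yhi i) (observed Y D) D delta)%E.
Proof.
apply: ae_le_expectation.
- exact: measurable_funM.
- by apply: measurable_m_up => //; exact: measurable_observed.
- by apply: filterS observed_order => w [? ? ?]; exact: le_m_up.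
Qed.

End bounds_proof.

(** * Choice of the interval by the common sign of the covariances *)

Theorem mainTheorem7
  (R : realType) (disp : measure_display) (Omega : measurableType disp)
  (P : probability Omega R) (T : nat)
  (D Z : {RV P >-> R}) (Y : 'I_T -> {RV P >-> R})
  (D_values : forall w : Omega, exists d : 'I_T, D w = level R d)
  (Y_integrable : forall d : 'I_T, P.-integrable [set: Omega] (EFin \o Y d))
  (Y_variance : forall d : 'I_T, (0 < 'V_P[Y d] < +oo)%E)
  (D_variance : (0 < 'V_P[D] < +oo)%E)
  (Z_variance : (0 < 'V_P[Z] < +oo)%E)
  (pos_eq : forall d : 'I_T, (0 < P [set w | D w = level R d])%E)
  (pos_neq : forall d : 'I_T, (0 < P [set w | D w <> level R d])%E)
  (ylo yhi : 'I_T -> R)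
  (BoS : forall d : 'I_T,
     cond_support P (Y d) [set w | D w <> level R d] = `[ylo d, yhi d]%classic /\
     cond_support P (Y d) [set w | D w = level R d] = `[ylo d, yhi d]%classic)
  (SDC : forall d : 'I_T,
     (0 <= covariance P (Y d) D * covariance P (Y d) Z)%E)
  (LEI : forall d : 'I_T,
     `|correlation P (Y d) Z| <= `|correlation P (Y d) D|)
  (MTR : forall d d' : 'I_T, (d' < d)%N ->
     {ae P, forall w, Y d' w <= Y d w}) :
  forall d : 'I_T,
    I_MTR P (level R d) (ylo d) (yhi d) (observed Y D) D Z ('E_P[Y d])%E.
Proof.
move=> i.
have [_ VYi] := andP (Y_variance i); have [_ VD] := andP D_variance.
have [_ VZ] := andP Z_variance.
have [Sneq Seq] := BoS i.
have Yb := ae_support_bounds (pos_eq i) (pos_neq i) Sneq Seq.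
(* [S b m] is the mean of [drift * Y i], so the weighted means are ['E_P[Y i]] plus or minus
   [a * S b m]. *)
pose S b m : R := ((1 - b) * m * std_dev P Z + b) * fine (covariance P (Y i) D)
  + ((1 - b) * (1 - m) - (1 - b) * m * std_dev P D)
    * fine (covariance P (Y i) Z).
have EfinY : ('E_P[Y i])%E \is a fin_num.
  exact/expectation_fin_num/Lfun1_integrable.
have mplus a b m : measurable_fun setT (deltaL_plus P D Z (a, b, m)).
  apply: measurable_funD => //; apply: measurable_funM => //.
  exact: measurable_drift.
have mminus a b m : measurable_fun setT (deltaL_minus P D Z (a, b, m)).
  apply: measurable_funB => //; apply: measurable_funM => //.
  exact: measurable_drift.
have Eplus a b m : ('E_P[fun w => (deltaL_plus P D Z (a, b, m) w * Y i w)%R]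
    = 'E_P[Y i] + (a * S b m)%:E)%E by exact: expectation_drift_weight.
have Eminus a b m : ('E_P[fun w => (deltaL_minus P D Z (a, b, m) w * Y i w)%R]
    = 'E_P[Y i] - (a * S b m)%:E)%E.
  rewrite /deltaL_minus; under eq_fun do rewrite -(mulNr a).
  by rewrite expectation_drift_weight // -EFinN -(mulNr a).
(* The sign is fixed before any parameter is introduced, so a single interval works for the whole
   cube. *)
have [[CD0 CZ0 CDZ]|[CD0 CZ0 CDZ]] :
    [/\ 0 <= fine (covariance P (Y i) D), 0 <= fine (covariance P (Y i) Z)
      & fine (covariance P (Y i) Z) * std_dev P D
        <= fine (covariance P (Y i) D) * std_dev P Z] \/
    [/\ 0 <= - fine (covariance P (Y i) D), 0 <= - fine (covariance P (Y i) Z)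
      & - fine (covariance P (Y i) Z) * std_dev P D
        <= - fine (covariance P (Y i) D) * std_dev P Z].
- apply: (@same_sign_covariances _ _ _ _ _ (std_dev P (Y i))) (LEI i);
    rewrite ?std_dev_gt0 //.
  by rewrite -lee_fin EFinM !fineK ?covariance_fin_num_centered // SDC.
(* Here [S] is nonnegative on the cube: [deltaL_minus] lowers the mean and [deltaL_plus] raises
   it. *)
- left; rewrite /I_MTR1 /= in_itv /=; apply/andP; split.
    apply: ge_ereal_sup => _ [[[a b] m] [[/= a01 b01] m01] <-].
    apply: le_trans (E_m_low_le D_values MTR Yb (mminus a b m)) _.
    rewrite Eminus geeDl // ?EfinY // leeNl oppe0 lee_fin.
    move: a01 b01 m01; rewrite /= !in_itv /= => /andP[a0 _] b01 m01.
    by rewrite mulr_ge0 // drift_coef_ge0.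
  apply: le_ereal_inf_tmp => _ [[[a b] m] [[/= a01 b01] m01] <-].
  apply: le_trans (le_E_m_up D_values MTR Yb (mplus a b m)).
  rewrite Eplus leeDl // lee_fin.
  move: a01 b01 m01; rewrite /= !in_itv /= => /andP[a0 _] b01 m01.
  by rewrite mulr_ge0 // drift_coef_ge0.
(* For nonpositive covariances the sign of [S] flips, and the two weights exchange roles. *)
- have S_le0 b m : 0 <= b <= 1 -> 0 <= m <= 1 -> S b m <= 0.
    move=> b01 m01; have := drift_coef_ge0 CD0 CZ0 CDZ b01 m01.
    by rewrite !mulrN -opprD oppr_ge0.
  right; rewrite /I_MTR2 /= in_itv /=; apply/andP; split.
    apply: ge_ereal_sup => _ [[[a b] m] [[/= a01 b01] m01] <-].
    apply: le_trans (E_m_low_le D_values MTR Yb (mplus a b m)) _.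
    rewrite Eplus geeDl // ?EfinY // lee_fin.
    move: a01 b01 m01; rewrite /= !in_itv /= => /andP[a0 _] b01 m01.
    by rewrite mulr_ge0_le0 // S_le0.
  apply: le_ereal_inf_tmp => _ [[[a b] m] [[/= a01 b01] m01] <-].
  apply: le_trans (le_E_m_up D_values MTR Yb (mminus a b m)).
  rewrite Eminus leeDl // leeNr oppe0 lee_fin.
  move: a01 b01 m01; rewrite /= !in_itv /= => /andP[a0 _] b01 m01.
  by rewrite mulr_ge0_le0 // S_le0.
Qed.
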